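(* Let $d_1,d_2,s,N\ge 1$ be integers and $h>0$. Let $f^{[1]}:\mathbb{R}^{d_1}\times\mathbb{R}^{d_2}\to\mathbb{R}^{d_1}$ and $f^{[2]}:\mathbb{R}^{d_1}\times\mathbb{R}^{d_2}\to\mathbb{R}^{d_2}$ be continuously differentiable, and let $C:\mathbb{R}^{d_1}\times\mathbb{R}^{d_2}\to\mathbb{R}$ be differentiable. Let $a^{[1]}=(a^{[1]}_{ij})$, $a^{[2]}=(a^{[2]}_{ij})$ be real $s\times s$ matrices and let $b^{[1]}=(b^{[1]}_i)$, $b^{[2]}=(b^{[2]}_i)$ be real vectors of length $s$ all of whose components are nonzero. Assume that the system $\frac{\mathrm{d}}{\mathrm{d}t}x^{[p]}=f^{[p]}(x^{[1]},x^{[2]})$, $p=1,2$, with initial condition $x^{[p]}(0)=\theta^{[p]}$, is solved by the partitioned Runge--Kutta (PRK) method with coefficients $(a^{[1]},b^{[1]})$, $(a^{[2]},b^{[2]})$ and step size $h$ (as defined in the context), producing $x_n^{[1]}(\theta),x_n^{[2]}(\theta)$, $n=0,\dots,N$, where $\theta=(\theta^{[1]},\theta^{[2]})\in\mathbb{R}^{d_1}\times\mathbb{R}^{d_2}$. Assume that the coefficients $A^{[pq]}=(A^{[pq]}_{ij})$ (real $s\times s$ matrices) and $B^{[pq]}=(B^{[pq]}_i)$ (real vectors of length $s$), $p,q\in\{1,2\}$, of the generalized PRK (GPRK) method (as defined in the context) applied to the adjoint system satisfy, for all $i,j=1,\dots,s$, \begin{align*} & b_i^{[1]} = B_i^{[11]}=B_i^{[21]},\\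 & b_i^{[2]} = B_i^{[12]}=B_i^{[22]},\\ & b_i^{[1]} A_{ij}^{[11]} + B_j^{[11]} a_{ji}^{[1]} = b_i^{[1]} B_j^{[11]},\\ & b_i^{[1]} A_{ij}^{[12]} + B_j^{[12]} a_{ji}^{[1]} = b_i^{[1]} B_j^{[12]},\\ & b_i^{[2]} A_{ij}^{[21]} + B_j^{[21]} a_{ji}^{[2]} = b_i^{[2]} B_j^{[21]},\\ & b_i^{[2]} A_{ij}^{[22]} + B_j^{[22]} a_{ji}^{[2]} = b_i^{[2]} B_j^{[22]}. \end{align*} Then solving the adjoint system by this GPRK method with the final condition $\lambda_N^{[1]}=\nabla_{x^{[1]}}C(x_N^{[1]}(\theta),x_N^{[2]}(\theta))$, $\lambda_N^{[2]}=\nabla_{x^{[2]}}C(x_N^{[1]}(\theta),x_N^{[2]}(\theta))$ yields the exact gradient: every solution $(\lambda_n^{[1]},\lambda_n^{[2]})_{n=0}^{N}$ of the GPRK equations (for $n=0,\dots,N-1$) with this final condition satisfies $$\lambda_0^{[1]}=\nabla_{\theta^{[1]}}\,C\bigl(x_N^{[1]}(\theta),x_N^{[2]}(\theta)\bigr),\qquad \lambda_0^{[2]}=\nabla_{\theta^{[2]}}\,C\bigl(x_N^{[1]}(\theta),x_N^{[2]}(\theta)\bigr).$$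
   Context: Gradients are column vectors; $\nabla_{x^{[q]}}f^{[p]}$ denotes the Jacobian matrix ($d_p\times d_q$) of $f^{[p]}$ with respect to its argument $x^{[q]}$. Subscript $n=0,\dots,N$ is the time-step index. PRK method: $x_0^{[p]}=\theta^{[p]}$ and, for $n=0,\dots,N-1$, $p=1,2$, $i=1,\dots,s$, \begin{align*} x_{n+1}^{[p]} &= x_n^{[p]}+h\sum_{i=1}^s b_i^{[p]}k_{n,i}^{[p]},\\ k_{n,i}^{[p]} &= f^{[p]}\bigl(X_{n,i}^{[1]},X_{n,i}^{[2]}\bigr),\\ X_{n,i}^{[p]} &= x_n^{[p]}+h\sum_{j=1}^s a_{ij}^{[p]}k_{n,j}^{[p]}. \end{align*} Standing convention: the (possibly implicit) stage equations are solved so that all $x_n^{[p]}(\theta)$, $X_{n,i}^{[p]}(\theta)$, $k_{n,i}^{[p]}(\theta)$ are differentiable functions of the initial condition $\theta$ (in a neighbourhood of the point $\theta$ considered). Adjoint system: $\frac{\mathrm{d}}{\mathrm{d}t}\begin{bmatrix}\lambda^{[1]}\\ \lambda^{[2]}\end{bmatrix}=-\begin{bmatrix}\nabla_{x^{[1]}}f^{[1]} & \nabla_{x^{[2]}}f^{[1]}\\ \nabla_{x^{[1]}}f^{[2]} & \nabla_{x^{[2]}}f^{[2]}\end{bmatrix}^\top\begin{bmatrix}\lambda^{[1]}\\ \lambda^{[2]}\end{bmatrix}$, with the Jacobians evaluated along $(x^{[1]},x^{[2]})$. GPRK method for the adjoint system: with $\nabla_{x^{[q]}}f_{n,i}^{[p]}:=\nabla_{x^{[q]}}f^{[p]}(X_{n,i}^{[1]},X_{n,i}^{[2]})$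 evaluated at the stage values of the PRK method above, for $n=0,\dots,N-1$, $p,q\in\{1,2\}$, $i=1,\dots,s$, \begin{align*} \lambda_{n+1}^{[p]} &= \lambda_n^{[p]}-h\sum_{i=1}^s\bigl(B_i^{[p1]}l_{n,i}^{[p1]}+B_i^{[p2]}l_{n,i}^{[p2]}\bigr),\\ l_{n,i}^{[pq]} &= (\nabla_{x^{[p]}}f_{n,i}^{[q]})^\top\Lambda_{n,i}^{[q]},\\ \Lambda_{n,i}^{[p]} &= \lambda_n^{[p]}-h\sum_{j=1}^s\bigl(A_{ij}^{[p1]}l_{n,j}^{[p1]}+A_{ij}^{[p2]}l_{n,j}^{[p2]}\bigr), \end{align*} where $\lambda_n^{[p]},\Lambda_{n,i}^{[p]},l_{n,i}^{[pq]}\in\mathbb{R}^{d_p}$. The equations are solved backward in $n$ from the prescribed $\lambda_N^{[1]},\lambda_N^{[2]}$. *)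

(* Defs.v *)
From mathcomp Require Import all_boot all_order all_algebra.
From mathcomp Require Import all_classical all_reals all_analysis.

Set Implicit Arguments.
Unset Strict Implicit.
Unset Printing Implicit Defensive.

Import Order.TTheory GRing.Theory Num.Theory.
Import numFieldNormedType.Exports.

Local Open Scope classical_set_scope.
Local Open Scope ring_scope.

Section Gradients.
Context {R : realType}.

(* Column-vector convention, i.e. the transpose of the library's ['J f x],
   which acts on row vectors from the right. *)
Definition jacobian_cV {m n : nat} (f : 'cV[R]_n -> 'cV[R]_m) (x : 'cV[R]_n) :
    'M[R]_(m, n) :=
  \matrix_(i < m, j < n) 'D_(delta_mx j 0) (fun y => f y i 0) x.

Definition gradient {n : nat} (g : 'cV[R]_n -> R) (x : 'cV[R]_n) : 'cV[R]_n :=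
  \col_(j < n) 'D_(delta_mx j 0) g x.

Context {d1 d2 : nat}.
Local Notation state := ('cV[R]_d1 * 'cV[R]_d2)%type.

Definition jacobian1 {m : nat} (f : state -> 'cV[R]_m) (x : state) :
    'M[R]_(m, d1) := jacobian_cV (fun y => f (y, x.2)) x.1.

Definition jacobian2 {m : nat} (f : state -> 'cV[R]_m) (x : state) :
    'M[R]_(m, d2) := jacobian_cV (fun y => f (x.1, y)) x.2.

Definition gradient1 (g : state -> R) (x : state) : 'cV[R]_d1 :=
  gradient (fun y => g (y, x.2)) x.1.

Definition gradient2 (g : state -> R) (x : state) : 'cV[R]_d2 :=
  gradient (fun y => g (x.1, y)) x.2.

Definition continuously_differentiable {m : nat} (f : state -> 'cV[R]_m) :=
  [/\ forall x, differentiable f x,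
      continuous (jacobian1 f) &
      continuous (jacobian2 f)].

End Gradients.

Section Methods.
Context {R : realType} {d1 d2 s : nat}.
Local Notation state := ('cV[R]_d1 * 'cV[R]_d2)%type.
Variables (N : nat) (h : R).
Variables (f1 : state -> 'cV[R]_d1) (f2 : state -> 'cV[R]_d2).

(* Time-indexed families are total on [nat]; only the values at n <= N
   (n < N for stage quantities) are constrained. *)
Record prk_solution (a1 a2 : 'M[R]_s) (b1 b2 : 'cV[R]_s) (theta : state)
    (x1 : nat -> 'cV[R]_d1) (x2 : nat -> 'cV[R]_d2)
    (X1 : nat -> 'I_s -> 'cV[R]_d1) (X2 : nat -> 'I_s -> 'cV[R]_d2)
    (k1 : nat -> 'I_s -> 'cV[R]_d1) (k2 : nat -> 'I_s -> 'cV[R]_d2) : Prop :=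
  PrkSolution {
    prk_init1 : x1 0%N = theta.1;
    prk_init2 : x2 0%N = theta.2;
    prk_step1 : forall n, (n < N)%N ->
      x1 n.+1 = x1 n + h *: \sum_(i < s) b1 i 0 *: k1 n i;
    prk_step2 : forall n, (n < N)%N ->
      x2 n.+1 = x2 n + h *: \sum_(i < s) b2 i 0 *: k2 n i;
    prk_slope1 : forall n i, (n < N)%N -> k1 n i = f1 (X1 n i, X2 n i);
    prk_slope2 : forall n i, (n < N)%N -> k2 n i = f2 (X1 n i, X2 n i);
    prk_stage1 : forall n i, (n < N)%N ->
      X1 n i = x1 n + h *: \sum_(j < s) a1 i j *: k1 n j;
    prk_stage2 : forall n i, (n < N)%N ->
      X2 n i = x2 n + h *: \sum_(j < s) a2 i j *: k2 n j
  }.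

(* [lpq] is the contribution of the q-th adjoint variable to the equation of
   the p-th one, hence the transposed Jacobian of f[q] with respect to x[p];
   the Jacobians are frozen at the stage values X1, X2 of the forward method. *)
Record adjoint_gprk_solution
    (A11 A12 A21 A22 : 'M[R]_s) (B11 B12 B21 B22 : 'cV[R]_s)
    (X1 : nat -> 'I_s -> 'cV[R]_d1) (X2 : nat -> 'I_s -> 'cV[R]_d2)
    (lam1 : nat -> 'cV[R]_d1) (lam2 : nat -> 'cV[R]_d2)
    (Lam1 : nat -> 'I_s -> 'cV[R]_d1) (Lam2 : nat -> 'I_s -> 'cV[R]_d2)
    (l11 l12 : nat -> 'I_s -> 'cV[R]_d1)
    (l21 l22 : nat -> 'I_s -> 'cV[R]_d2) : Prop :=
  AdjointGprkSolution {
    gprk_step1 : forall n, (n < N)%N ->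
      lam1 n.+1 =
        lam1 n - h *: \sum_(i < s) (B11 i 0 *: l11 n i + B12 i 0 *: l12 n i);
    gprk_step2 : forall n, (n < N)%N ->
      lam2 n.+1 =
        lam2 n - h *: \sum_(i < s) (B21 i 0 *: l21 n i + B22 i 0 *: l22 n i);
    gprk_slope11 : forall n i, (n < N)%N ->
      l11 n i = (jacobian1 f1 (X1 n i, X2 n i))^T *m Lam1 n i;
    gprk_slope12 : forall n i, (n < N)%N ->
      l12 n i = (jacobian1 f2 (X1 n i, X2 n i))^T *m Lam2 n i;
    gprk_slope21 : forall n i, (n < N)%N ->
      l21 n i = (jacobian2 f1 (X1 n i, X2 n i))^T *m Lam1 n i;
    gprk_slope22 : forall n i, (n < N)%N ->
      l22 n i = (jacobian2 f2 (X1 n i, X2 n i))^T *m Lam2 n i;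
    gprk_stage1 : forall n i, (n < N)%N ->
      Lam1 n i =
        lam1 n - h *: \sum_(j < s) (A11 i j *: l11 n j + A12 i j *: l12 n j);
    gprk_stage2 : forall n i, (n < N)%N ->
      Lam2 n i =
        lam2 n - h *: \sum_(j < s) (A21 i j *: l21 n j + A22 i j *: l22 n j)
  }.

End Methods.

(* Main.v *)
(* Differentiating the forward method in a direction v of the initial condition
   gives the same method applied to the variational equation. The coefficient
   conditions make the bilinear pairing <lam_n, D_v x_n> of the adjoint with
   the variational solution independent of n: in each component it changes in
   one step by h sum_i (b_i <Lam_i, D_v k_i> - <G_i, D_v X_i>), with G_i the
   weighted adjoint slope, and these defects cancel when the two components are
   added, the adjoint slopes being built from the transposed Jacobians. At n = N
   the pairing is the derivative of C(x_N) along v by the chain rule; at n = 0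
   it is <lam_0, v>. *)

From HB Require Import structures.
Require Import Defs.
From mathcomp Require Import all_boot all_order all_algebra.
From mathcomp Require Import all_classical all_reals all_analysis.
From mathcomp Require Import ring.

Import Order.TTheory GRing.Theory Num.Theory.
Import numFieldNormedType.Exports.

Local Open Scope classical_set_scope.
Local Open Scope ring_scope.

(** * Euclidean pairing of column vectors *)

Section Dot.
Context {R : realType}.

(** Encoded as the single entry of a matrix product, so that bilinearity and the passage to the
    transpose are inherited from matrix algebra. *)
Definition dot {d : nat} (u v : 'cV[R]_d) : R := (u^T *m v) 0 0.

Lemma dotE d (u v : 'cV[R]_d) : dot u v = \sum_i u i 0 * v i 0.
Proof. by rewrite /dot mxE; apply: eq_bigr => i _; rewrite mxE. Qed.

Lemma dotDl d (u u' v : 'cV[R]_d) : dot (u + u') v = dot u v + dot u' v.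
Proof. by rewrite /dot linearD mulmxDl mxE. Qed.

Lemma dotBl d (u u' v : 'cV[R]_d) : dot (u - u') v = dot u v - dot u' v.
Proof. by rewrite /dot linearB mulmxBl !mxE. Qed.

Lemma dotZl d c (u v : 'cV[R]_d) : dot (c *: u) v = c * dot u v.
Proof. by rewrite /dot linearZ -scalemxAl mxE. Qed.

Lemma dotDr d (u v v' : 'cV[R]_d) : dot u (v + v') = dot u v + dot u v'.
Proof. by rewrite /dot mulmxDr mxE. Qed.

Lemma dotZr d c (u v : 'cV[R]_d) : dot u (c *: v) = c * dot u v.
Proof. by rewrite /dot -scalemxAr mxE. Qed.

Lemma dot0r d (u : 'cV[R]_d) : dot u 0 = 0.
Proof. by rewrite /dot mulmx0 mxE. Qed.

Lemma dot_suml d s (u : 'I_s -> 'cV[R]_d) v :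
  dot (\sum_i u i) v = \sum_i dot (u i) v.
Proof. by rewrite /dot linear_sum mulmx_suml summxE. Qed.

Lemma dot_sumr d s u (v : 'I_s -> 'cV[R]_d) :
  dot u (\sum_i v i) = \sum_i dot u (v i).
Proof. by rewrite /dot mulmx_sumr summxE. Qed.

Lemma dot_deltar d (u : 'cV[R]_d) j : dot u (delta_mx j 0) = u j 0.
Proof.
rewrite dotE (bigD1 j)//= mxE !eqxx mulr1 big1 ?addr0// => i /negPf ij.
by rewrite mxE ij mulr0.
Qed.

Lemma dot_trmx_mulmx m d (A : 'M[R]_(m, d)) u v :
  dot (A^T *m u) v = dot u (A *m v).
Proof. by rewrite /dot trmx_mul trmxK mulmxA. Qed.

End Dot.

(** * Change of the pairing over one step, for a single component *)

Section SymplecticStep.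
Context {R : realType}.

(** Expanding the left side leaves first-order terms in [lam] and [del] and a second-order term in
    the slopes. Eliminating [lam] and [del] in favour of the stage values [Lam] and [Xi] produces
    double sums weighted by [a]; these agree after exchanging indices and cancel, and the weights
    [b] absorb the second-order term. The stage relation is assumed already multiplied by [b i 0],
    so nothing is divided here. *)
Lemma dot_step_defect d s (h : R) (a : 'M[R]_s) (b : 'cV[R]_s)
    (lam lam' del del' : 'cV[R]_d) (G Lam kap Xi : 'I_s -> 'cV[R]_d) :
  lam' = lam - h *: \sum_i G i ->
  (forall i, b i 0 *: Lam i =
     b i 0 *: lam - h *: \sum_j (b i 0 - a j i) *: G j) ->
  del' = del + h *: \sum_i b i 0 *: kap i ->
  (forall i, Xi i = del + h *: \sum_j a i j *: kap j) ->
  dot lam' del' - dot lam del =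
    h * \sum_i (b i 0 * dot (Lam i) (kap i) - dot (G i) (Xi i)).
Proof.
move=> -> hLam -> hXi.
set K := \sum_i b i 0 *: kap i; set S := \sum_i G i.
have -> : \sum_i (b i 0 * dot (Lam i) (kap i) - dot (G i) (Xi i)) =
    dot lam K - dot S del - h * dot S K; last first.
  by rewrite dotBl !dotDr !dotZl !dotZr; ring.
rewrite sumrB.
have -> : \sum_i b i 0 * dot (Lam i) (kap i) = dot lam K
    - h * (dot S K - \sum_i \sum_j a i j * dot (G i) (kap j)).
  rewrite exchange_big dot_suml.
  under [X in _ - _ * (X - _)]eq_bigr do rewrite dot_sumr.
  rewrite [X in _ - _ * (X - _)]exchange_big /= -sumrB.
  rewrite dot_sumr mulr_sumr -sumrB.
  apply: eq_bigr => i _; rewrite -dotZl hLam dotBl !dotZl dot_suml dotZr.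
  rewrite -sumrB; congr (_ - _ * _); apply: eq_bigr => j _.
  by rewrite dotZl dotZr; ring.
have -> : \sum_i dot (G i) (Xi i) = dot S del
    + h * \sum_i \sum_j a i j * dot (G i) (kap j).
  rewrite dot_suml mulr_sumr -big_split/=; apply: eq_bigr => i _.
  rewrite hXi dotDr dotZr dot_sumr; congr (_ + _ * _).
  by apply: eq_bigr => j _; rewrite dotZr.
by ring.
Qed.

(* The symplecticity conditions trade the adjoint coefficients for
   b_i - a_ji, uniformly in the two families of slopes. *)
Lemma adjoint_stage_elim d s (h : R) (a A A' : 'M[R]_s) (b B B' : 'cV[R]_s)
    (lam : 'cV[R]_d) (Lam l l' : 'I_s -> 'cV[R]_d) i :
  (forall j, b i 0 * A i j + B j 0 * a j i = b i 0 * B j 0) ->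
  (forall j, b i 0 * A' i j + B' j 0 * a j i = b i 0 * B' j 0) ->
  Lam i = lam - h *: \sum_j (A i j *: l j + A' i j *: l' j) ->
  b i 0 *: Lam i = b i 0 *: lam
    - h *: \sum_j (b i 0 - a j i) *: (B j 0 *: l j + B' j 0 *: l' j).
Proof.
move=> hA hA' ->; rewrite scalerBr; congr (_ - _).
rewrite scalerA mulrC -scalerA; congr (_ *: _); rewrite scaler_sumr.
apply: eq_bigr => j _; rewrite !scalerDr !scalerA.
by congr (_ *: _ + _ *: _);
  [have := hA j|have := hA' j] => /(canRL (addrK _)) ->; ring.
Qed.

End SymplecticStep.

(** * Directional derivatives and partial Jacobians on a product space *)

Section Derivatives.
Context {R : realType}.

Lemma derive_comp_pair {V W1 W2 W : normedModType R} (F : W1 * W2 -> W)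
    (g1 : V -> W1) (g2 : V -> W2) x v :
  differentiable g1 x -> differentiable g2 x ->
  differentiable F (g1 x, g2 x) ->
  'D_v (fun t => F (g1 t, g2 t)) x = 'd F (g1 x, g2 x) ('D_v g1 x, 'D_v g2 x).
Proof.
move=> dg1 dg2 dF; have dg := differentiable_pair dg1 dg2.
rewrite !deriveE//; last exact: (differentiable_comp dg dF).
by rewrite (diff_comp dg dF)/= diff_pair.
Qed.

(** Both sides are limits of one and the same difference quotient, so the identity holds for an
    arbitrary [F]. It lets the partial derivatives inside gradients and Jacobians be read as values
    of the full differential. *)
Lemma derive_pair1 {W1 W2 W : normedModType R} (F : W1 * W2 -> W) x u :
  'D_u (fun y => F (y, x.2)) x.1 = 'D_(u, 0) F x.
Proof.
case: x => x y; rewrite /derive.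
set g1 := fun e => e^-1 *: _; set g2 := fun e => e^-1 *: _.
suff -> : g1 = g2 by [].
apply/funext => e; rewrite /g1 /g2 /=; congr (_ *: (F _ - _)).
by congr (_, _); rewrite /= scaler0 add0r.
Qed.

Lemma derive_pair2 {W1 W2 W : normedModType R} (F : W1 * W2 -> W) x u :
  'D_u (fun y => F (x.1, y)) x.2 = 'D_(0, u) F x.
Proof.
case: x => x y; rewrite /derive.
set g1 := fun e => e^-1 *: _; set g2 := fun e => e^-1 *: _.
suff -> : g1 = g2 by [].
apply/funext => e; rewrite /g1 /g2 /=; congr (_ *: (F _ - _)).
by congr (_, _); rewrite /= scaler0 add0r.
Qed.

Lemma derive_fst {W1 W2 : normedModType R} (x v : W1 * W2) :
  'D_v fst x = v.1.
Proof.
have cfst : continuous (fst : W1 * W2 -> W1) by move=> y; exact: cvg_fst.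
by rewrite deriveE ?diff_lin//; exact: linear_differentiable.
Qed.

Lemma derive_snd {W1 W2 : normedModType R} (x v : W1 * W2) :
  'D_v snd x = v.2.
Proof.
have csnd : continuous (snd : W1 * W2 -> W2) by move=> y; exact: cvg_snd.
by rewrite deriveE ?diff_lin//; exact: linear_differentiable.
Qed.

Lemma cV_sum_delta d (u : 'cV[R]_d) : u = \sum_j u j 0 *: delta_mx j 0.
Proof.
by rewrite {1}[u]matrix_sum_delta; apply: eq_bigr => i _; rewrite big_ord1.
Qed.

Context {d1 d2 : nat}.
Local Notation state := ('cV[R]_d1 * 'cV[R]_d2)%type.

Lemma diff_gradients (g : state -> R) x u w : differentiable g x ->
  'd g x (u, w) = dot (gradient1 g x) u + dot (gradient2 g x) w.
Proof.
move=> dg.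
(* Expand the direction in the coordinate basis of the product; linearity of the differential then
   reduces everything to partial derivatives. *)
have duw : (u, w) = \sum_j u j 0 *: ((delta_mx j 0, 0) : state)
    + \sum_j w j 0 *: ((0, delta_mx j 0) : state).
  apply/pair_equal_spec; split.
    rewrite /= !raddf_sum /= [X in _ + X]big1 ?addr0; last first.
      by move=> j _; rewrite scaler0.
    exact: cV_sum_delta.
  rewrite /= !raddf_sum /= big1 ?add0r; last first.
    by move=> j _; rewrite scaler0.
  exact: cV_sum_delta.
rewrite duw linearD !linear_sum !dotE; congr (_ + _); apply: eq_bigr => j _.
  by rewrite linearZ mxE derive_pair1 deriveE// mulrC.
by rewrite linearZ mxE derive_pair2 deriveE// mulrC.
Qed.

Lemma diff_jacobians m (F : state -> 'cV[R]_m) x u w : differentiable F x ->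
  'd F x (u, w) = jacobian1 F x *m u + jacobian2 F x *m w.
Proof.
move=> dF; apply/colP => i.
pose co (M : 'cV[R]_m) : R := M i 0.
have dco M : differentiable co M by exact: differentiable_coord.
(* Taking a coordinate is linear and continuous, hence its own differential; each row thus reduces
   to the scalar case of gradients. *)
have -> : 'd F x (u, w) i 0 = 'd (co \o F) x (u, w).
  have colin : linear co by move=> e A B; rewrite /co !mxE.
  pose coM := GRing.isLinear.Build _ _ _ _ _ colin.
  pose coL : {linear _ -> _} := HB.pack co coM.
  rewrite (diff_comp dF (dco _))/= -[co]/(coL : _ -> _) diff_lin//.
  exact: coord_continuous.
rewrite diff_gradients; last exact: differentiable_comp.
by rewrite !dotE !mxE; congr (_ + _); apply: eq_bigr => j _; rewrite !mxE.
Qed.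

(** Common shape of the update and stage equations of the forward method. The relation is only asked
    near [t], since a directional derivative depends only on the germ. *)
Lemma derive_affine {V W : normedModType R} s (h : R) (c : 'I_s -> R)
    (y x : V -> W) (k : V -> 'I_s -> W) t v :
  differentiable x t -> (forall i, differentiable (k^~ i) t) ->
  (\forall u \near t, y u = x u + h *: \sum_i c i *: k u i) ->
  'D_v y t = 'D_v x t + h *: \sum_i c i *: 'D_v (k^~ i) t.
Proof.
move=> dx dk hy.
rewrite (near_eq_derive (g := x + h *: \sum_i c i *: k^~ i)); last first.
  near=> u; rewrite (near hy)//=.
  by rewrite !fctE fct_sumE.
have dck i : derivable (c i *: k^~ i) t v by apply/derivableZ/diff_derivable.
rewrite deriveD ?deriveZ ?derive_sum//; first last.
- exact/derivableZ/derivable_sum.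
- exact: diff_derivable.
- exact: derivable_sum.
congr (_ + _ *: _); apply: eq_bigr => i _; rewrite deriveZ//.
exact/diff_derivable.
Unshelve. all: by end_near. Qed.

End Derivatives.

(** * Conservation of the pairing along the trajectory, and its two end values *)

Theorem theorem2 (R : realType) (d1 d2 s N : nat) (h : R)
  (hd1 : (0 < d1)%N) (hd2 : (0 < d2)%N) (hs : (0 < s)%N) (hN : (0 < N)%N)
  (h_gt0 : 0 < h)
  (f1 : 'cV[R]_d1 * 'cV[R]_d2 -> 'cV[R]_d1)
  (f2 : 'cV[R]_d1 * 'cV[R]_d2 -> 'cV[R]_d2)
  (C : 'cV[R]_d1 * 'cV[R]_d2 -> R)
  (hf1 : continuously_differentiable f1)
  (hf2 : continuously_differentiable f2)
  (hC : forall x, differentiable C x)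
  (a1 a2 : 'M[R]_s) (b1 b2 : 'cV[R]_s)
  (hb1 : forall i, b1 i 0 != 0) (hb2 : forall i, b2 i 0 != 0)
  (theta : 'cV[R]_d1 * 'cV[R]_d2)
  (x1 : 'cV[R]_d1 * 'cV[R]_d2 -> nat -> 'cV[R]_d1)
  (x2 : 'cV[R]_d1 * 'cV[R]_d2 -> nat -> 'cV[R]_d2)
  (X1 k1 : 'cV[R]_d1 * 'cV[R]_d2 -> nat -> 'I_s -> 'cV[R]_d1)
  (X2 k2 : 'cV[R]_d1 * 'cV[R]_d2 -> nat -> 'I_s -> 'cV[R]_d2)
  (hprk : \forall t \near theta,
    prk_solution N h f1 f2 a1 a2 b1 b2 t
      (x1 t) (x2 t) (X1 t) (X2 t) (k1 t) (k2 t))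
  (hx_diff : \forall t \near theta, forall n, (n <= N)%N ->
    differentiable (x1^~ n) t /\ differentiable (x2^~ n) t)
  (hstage_diff : \forall t \near theta, forall n i, (n < N)%N ->
    [/\ differentiable (fun u => X1 u n i) t,
        differentiable (fun u => X2 u n i) t,
        differentiable (fun u => k1 u n i) t &
        differentiable (fun u => k2 u n i) t])
  (A11 A12 A21 A22 : 'M[R]_s) (B11 B12 B21 B22 : 'cV[R]_s)
  (hB1 : forall i, b1 i 0 = B11 i 0 /\ B11 i 0 = B21 i 0)
  (hB2 : forall i, b2 i 0 = B12 i 0 /\ B12 i 0 = B22 i 0)
  (hA11 : forall i j,
    b1 i 0 * A11 i j + B11 j 0 * a1 j i = b1 i 0 * B11 j 0)
  (hA12 : forall i j,
    b1 i 0 * A12 i j + B12 j 0 * a1 j i = b1 i 0 * B12 j 0)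
  (hA21 : forall i j,
    b2 i 0 * A21 i j + B21 j 0 * a2 j i = b2 i 0 * B21 j 0)
  (hA22 : forall i j,
    b2 i 0 * A22 i j + B22 j 0 * a2 j i = b2 i 0 * B22 j 0)
  (lam1 : nat -> 'cV[R]_d1) (lam2 : nat -> 'cV[R]_d2)
  (Lam1 : nat -> 'I_s -> 'cV[R]_d1) (Lam2 : nat -> 'I_s -> 'cV[R]_d2)
  (l11 l12 : nat -> 'I_s -> 'cV[R]_d1) (l21 l22 : nat -> 'I_s -> 'cV[R]_d2)
  (hgprk : adjoint_gprk_solution N h f1 f2 A11 A12 A21 A22 B11 B12 B21 B22
    (X1 theta) (X2 theta) lam1 lam2 Lam1 Lam2 l11 l12 l21 l22)
  (hfinal1 : lam1 N = gradient1 C (x1 theta N, x2 theta N))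
  (hfinal2 : lam2 N = gradient2 C (x1 theta N, x2 theta N)) :
  lam1 0%N = gradient1 (fun t => C (x1 t N, x2 t N)) theta /\
  lam2 0%N = gradient2 (fun t => C (x1 t N, x2 t N)) theta.
Proof.
have dx := nbhs_singleton hx_diff.
have dX := nbhs_singleton hstage_diff.
pose S v n := dot (lam1 n) ('D_v (x1^~ n) theta)
  + dot (lam2 n) ('D_v (x2^~ n) theta).
have S_step v n : (n < N)%N -> S v n.+1 = S v n.
  move=> nN; have [dx1 dx2] := dx _ (ltnW nN).
  have dX1 i : differentiable (fun u => X1 u n i) theta by have [] := dX n i nN.
  have dX2 i : differentiable (fun u => X2 u n i) theta by have [] := dX n i nN.
  have dk1 i : differentiable (fun u => k1 u n i) theta by have [] := dX n i nN.
  have dk2 i : differentiable (fun u => k2 u n i) theta by have [] := dX n i nN.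
  pose D1 := fun i => 'D_v (fun u => X1 u n i) theta.
  pose D2 := fun i => 'D_v (fun u => X2 u n i) theta.
  (* Variational equation for the slopes: the slope equation holds for all initial conditions near
     [theta], so it may be differentiated there. *)
  have dkE1 i : 'D_v (fun u => k1 u n i) theta =
      jacobian1 f1 (X1 theta n i, X2 theta n i) *m D1 i
      + jacobian2 f1 (X1 theta n i, X2 theta n i) *m D2 i.
    rewrite (near_eq_derive (g := fun u => f1 (X1 u n i, X2 u n i)));
      last first.
      by near=> u; apply: (prk_slope1 (near hprk u _)).
    by case: hf1 => df1 _ _; rewrite derive_comp_pair// diff_jacobians.
  have dkE2 i : 'D_v (fun u => k2 u n i) theta =
      jacobian1 f2 (X1 theta n i, X2 theta n i) *m D1 i
      + jacobian2 f2 (X1 theta n i, X2 theta n i) *m D2 i.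
    rewrite (near_eq_derive (g := fun u => f2 (X1 u n i, X2 u n i)));
      last first.
      by near=> u; apply: (prk_slope2 (near hprk u _)).
    by case: hf2 => df2 _ _; rewrite derive_comp_pair// diff_jacobians.
  have H1 := @dot_step_defect R d1 s h a1 b1 (lam1 n) (lam1 n.+1)
    ('D_v (x1^~ n) theta) ('D_v (x1^~ n.+1) theta)
    (fun i => B11 i 0 *: l11 n i + B12 i 0 *: l12 n i) (Lam1 n)
    (fun i => 'D_v (fun u => k1 u n i) theta) D1.
  have H2 := @dot_step_defect R d2 s h a2 b2 (lam2 n) (lam2 n.+1)
    ('D_v (x2^~ n) theta) ('D_v (x2^~ n.+1) theta)
    (fun i => B21 i 0 *: l21 n i + B22 i 0 *: l22 n i) (Lam2 n)
    (fun i => 'D_v (fun u => k2 u n i) theta) D2.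
  (* Regroup the change of [S] by component, so that each bracket is a one-step defect. The premises
     come in reverse order: forward stage, forward update, adjoint stage, adjoint update. *)
  apply/eqP; rewrite -subr_eq0 /S opprD addrACA H1; first last.
  - move=> i; apply: derive_affine => //; near=> u.
    exact: (prk_stage1 (near hprk u _)).
  - apply: derive_affine => //; near=> u.
    exact: (prk_step1 (near hprk u _)).
  - move=> i; apply: adjoint_stage_elim => [j|j|]; [exact: hA11|exact: hA12|].
    exact: (gprk_stage1 hgprk).
  - exact: (gprk_step1 hgprk).
  rewrite H2; first last.
  - move=> i; apply: derive_affine => //; near=> u.
    exact: (prk_stage2 (near hprk u _)).
  - apply: derive_affine => //; near=> u.
    exact: (prk_step2 (near hprk u _)).
  - move=> i; apply: adjoint_stage_elim => [j|j|]; [exact: hA21|exact: hA22|].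
    exact: (gprk_stage2 hgprk).
  - exact: (gprk_step2 hgprk).
  (* The two defects cancel stage by stage: slopes built from the Jacobians of [f1] all carry weight
     [b1], those from [f2] weight [b2], and moving the transposed Jacobians across the pairing
     matches them with the variational slopes. *)
  rewrite -mulrDr -big_split/= big1 ?mulr0// => i _.
  rewrite dkE1 dkE2 (gprk_slope11 hgprk)// (gprk_slope12 hgprk)//.
  rewrite (gprk_slope21 hgprk)// (gprk_slope22 hgprk)//.
  have [-> <-] := hB1 i; have [-> <-] := hB2 i.
  by rewrite !dotDl !dotZl !dotDr !dot_trmx_mulmx; ring.
have S_const v n : (n <= N)%N -> S v n = S v 0%N.
  elim: n => [_|n IHn nN]; first reflexivity.
  by rewrite (S_step v n nN); exact/IHn/ltnW.
have [dxN1 dxN2] := dx _ (leqnn N).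
have derC v : 'D_v (fun t => C (x1 t N, x2 t N)) theta = S v 0%N.
  by rewrite -(S_const v N)// /S hfinal1 hfinal2 derive_comp_pair//
    diff_gradients.
(* Near [theta], the maps giving the initial values are the two projections. *)
have S0 v : S v 0%N = dot (lam1 0%N) v.1 + dot (lam2 0%N) v.2.
  rewrite /S (near_eq_derive (g := fst)); last first.
    by near=> u; exact: (prk_init1 (near hprk u _)).
  rewrite [X in _ + dot _ X](near_eq_derive (g := snd)); last first.
    by near=> u; exact: (prk_init2 (near hprk u _)).
  by rewrite derive_fst derive_snd.
(* The directions [(delta_mx j 0, 0)] and [(0, delta_mx j 0)] extract the individual entries. *)
split; apply/colP => j; rewrite mxE.
  by rewrite (derive_pair1 (fun t => C (x1 t N, x2 t N)))
    derC S0 dot0r addr0 dot_deltar.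
by rewrite (derive_pair2 (fun t => C (x1 t N, x2 t N)))
  derC S0 dot0r add0r dot_deltar.
Unshelve. all: by end_near.
Qed.
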